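(* Let $\mathfrak{p}$ be the pseudointersection number. For each unbounded tower $T\subseteq[\mathbb{N}]^{\aleph_0}$ of cardinality $\mathfrak{p}$, the set $T\cup[\mathbb{N}]^{<\aleph_0}$, considered as a topological subspace of $P(\mathbb{N})$, satisfies $\mathsf{S}_1(\Omega,\Gamma)$ (that is, it is a $\gamma$-set).
   Context: The power set $P(\mathbb{N})$ is identified with the Cantor space $\{0,1\}^{\mathbb{N}}$ (with the Tychonoff product topology) via characteristic functions, and carries the resulting topology. $[\mathbb{N}]^{\aleph_0}$ is the family of infinite subsets of $\mathbb{N}$ and $[\mathbb{N}]^{<\aleph_0}$ the family of finite subsets of $\mathbb{N}$, so $P(\mathbb{N})=[\mathbb{N}]^{\aleph_0}\cup[\mathbb{N}]^{<\aleph_0}$. $A\subseteq^* B$ means that $A\setminus B$ is finite. An infinite set $A\subseteq\mathbb{N}$ is a pseudointersection of a family $\mathcal{F}$ if $A\subseteq^* B$ for all $B\in\mathcal{F}$. The cardinal $\mathfrak{p}$ is the minimal cardinality of a family $\mathcal{F}$ of infinite subsets of $\mathbb{N}$ which is closed under finite intersections and has no (infinite) pseudointersection. For $f,g\in\mathbb{N}^{\mathbb{N}}$, $f\le^* g$ means $f(n)\le g(n)$ for all but finitely many $n$. A set $B\subseteq[\mathbb{N}]^{\aleph_0}$ is unbounded if the set of all increasing enumerations of elements of $B$ is unbounded in $\mathbb{N}^{\mathbb{N}}$ with respect to $\le^*$, i.e. there is no $g\in\mathbb{N}^{\mathbb{N}}$ with $f\le^* g$ for all such enumerations $f$. A tower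 of cardinality $\kappa$ is a set $T\subseteq[\mathbb{N}]^{\aleph_0}$ which can be enumerated bijectively as $\{x_\alpha:\alpha<\kappa\}$ such that for all $\alpha<\beta<\kappa$, $x_\beta\subseteq^* x_\alpha$. An unbounded tower of cardinality $\kappa$ is an unbounded set $T\subseteq[\mathbb{N}]^{\aleph_0}$ which is a tower of cardinality $\kappa$. For a topological space $X$: $\Omega(X)$ is the collection of open $\omega$-covers of $X$, i.e. families $\mathcal{U}$ of open subsets of $X$ with $X\notin\mathcal{U}$ such that each finite subset of $X$ is contained in some member of $\mathcal{U}$. $\Gamma(X)$ is the collection of open $\gamma$-covers of $X$, i.e. infinite families $\mathcal{U}$ of open subsets of $X$ with $X\notin\mathcal{U}$ such that each point of $X$ belongs to all but finitely many members of $\mathcal{U}$. $X$ satisfies $\mathsf{S}_1(\Omega,\Gamma)$ if for each sequence $\mathcal{U}_1,\mathcal{U}_2,\dots\in\Omega(X)$ there are $U_n\in\mathcal{U}_n$, $n\in\mathbb{N}$, such that $\{U_n:n\in\mathbb{N}\}\in\Gamma(X)$. Equivalently (Gerlits and Nagy), each $\mathcal{U}\in\Omega(X)$ contains a set $\mathcal{V}\in\Gamma(X)$. Spaces satisfying $\mathsf{S}_1(\Omega,\Gamma)$ are called $\gamma$-sets. *)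

(* Defs.v *)
From HB Require Import structures.
From mathcomp Require Import all_boot all_order.
From mathcomp Require Import all_classical all_reals all_analysis.
From mathcomp Require wochoice.

Set Implicit Arguments.
Unset Strict Implicit.
Unset Printing Implicit Defensive.

Local Open Scope classical_set_scope.
Local Open Scope card_scope.

(* A cardinal is an initial ordinal: a well-ordered type that does not inject
   into any of its proper initial segments. Its elements play the role of the
   ordinals [alpha < kappa]. *)
Record cardinal := Cardinal {
  card_sort :> Type;
  card_rel : rel card_sort;
  card_wo : wochoice.well_order card_rel;
  card_initial : forall a : card_sort,
    ~ ([set: card_sort] #<= [set b : card_sort | card_rel b a /\ b <> a]) }.

Definition ord_lt (kappa : cardinal) (a b : kappa) : Prop :=
  card_rel a b /\ a <> b.

Definition inf_subsets : set (set nat) := [set A | infinite_set A].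
Definition fin_subsets : set (set nat) := [set A | finite_set A].

Definition almost_subset (A B : set nat) : Prop := finite_set (A `\` B).

Definition pseudointersection (F : set (set nat)) (A : set nat) : Prop :=
  infinite_set A /\ forall B, F B -> almost_subset A B.

Definition closed_family_without_pseudointersection (F : set (set nat)) : Prop :=
  [/\ F `<=` inf_subsets, setI_closed F & ~ exists A, pseudointersection F A].

Definition is_pseudointersection_number (kappa : cardinal) : Prop :=
  (exists2 F, closed_family_without_pseudointersection F & F #= [set: kappa]) /\
  (forall F, closed_family_without_pseudointersection F -> [set: kappa] #<= F).

Definition le_star (f g : nat -> nat) : Prop :=
  \forall n \near \oo, (f n <= g n)%N.

Definition increasing_enumeration (A : set nat) (e : nat -> nat) : Prop :=
  {homo e : m n / (m < n)%N} /\ range e = A.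

Definition unbounded_family (B : set (set nat)) : Prop :=
  ~ exists g : nat -> nat,
      forall A e, B A -> increasing_enumeration A e -> le_star e g.

Definition tower (kappa : cardinal) (T : set (set nat)) : Prop :=
  T `<=` inf_subsets /\
  exists x : kappa -> set nat,
    set_bij [set: kappa] T x /\
    forall a b : kappa, ord_lt a b -> almost_subset (x b) (x a).

Definition unbounded_tower (kappa : cardinal) (T : set (set nat)) : Prop :=
  tower kappa T /\ unbounded_family T.

Definition char_fun (A : set nat) : cantor_space := fun n => n \in A.

(* [char_fun] is a bijection, so the initial topology it induces on [set nat]
   is the topology of the Cantor space transported along it. *)
Definition powerset_nat : Type := initial_topology char_fun.

HB.instance Definition _ := Topological.on powerset_nat.

Definition Omega (X : topologicalType) : set (set (set X)) :=
  [set U | [/\ U `<=` open, ~ U [set: X] &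
             forall F : set X, finite_set F -> exists2 V, U V & F `<=` V]].

Definition Gamma (X : topologicalType) : set (set (set X)) :=
  [set U | [/\ infinite_set U, U `<=` open, ~ U [set: X] &
             forall x : X, finite_set [set V | U V /\ ~ V x]]].

Definition S1 (X : Type) (A B : set (set (set X))) : Prop :=
  forall U : nat -> set (set X), (forall n, A (U n)) ->
  exists V : nat -> set X, (forall n, U n (V n)) /\ B (range V).

(* Applied to the type [set_type A] of points of [A : set Y], whose library
   topology is the initial one for the inclusion into [Y]; the library's
   [subspace A] would instead add isolated points outside [A]. *)
Definition gamma_set (X : topologicalType) : Prop := S1 (@Omega X) (@Gamma X).

(* Main.v *)
(* By the Galvin-Miller argument, an omega-cover contains sets [V n] to which
one can attach intervals [a n, b n) such that every point missing [a n, b n)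
lies in [V n]. The tower being unbounded, some [x d] misses infinitely many of
these intervals, so after thinning out almost all [V n] contain every point of
the tower from [x d] on. An initial segment of the tower has fewer than p
points; hence the [V n] can also be chosen so that almost all of them contain
each point before a prescribed [x c].
Apply this to the [k]-th cover with [c = c k], and let [c k.+1 = d]. For each
point of the tower there is at most one [k] such that the point is outside
infinitely many members of the [k]-th sequence. The tower has no countable
cofinal subset, so some [w] lies above all the [c k]. The fewer than p points
before [x w] admit a common bound, modulo finitely many [k], on how far one
must go in the [k]-th sequence; going further, one picks a member whose
interval is missed by [x w], hence, for almost all [k], by each point after
[x w]. *)
Require Import Defs.
From mathcomp Require Import all_boot all_order.
From mathcomp Require Import all_classical all_reals all_analysis.

Set Implicit Arguments.
Unset Strict Implicit.
Unset Printing Implicit Defensive.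

Local Open Scope classical_set_scope.
Local Open Scope card_scope.

(** * Comparing cardinalities by means of partial injections *)

Lemma card_leTP (A B : Type) :
  [set: A] #<= [set: B] <-> exists f : A -> B, injective f.
Proof.
split=> [/card_leP[f]|[f f_inj]].
  exists (fun a => set_val (f (SigSub (mem_set (I : [set: A] a))))) => a b.
  move=> /val_inj /(@inj _ _ _ f); rewrite !inE => /(_ Logic.I Logic.I).
  by case.
apply: (@card_le_trans _ _ _ (range f)); last exact: card_leT.
by rewrite (card_le_eqr (inj_card_eq (in2W f_inj))).
Qed.

Lemma notin_setP T (A : set T) x : reflect (~ A x) (x \notin A).
Proof. by rewrite -notin_setE; exact: idP. Qed.

(** The equivalence makes [G] single-valued and injective at once. *)
Definition partial_inj T U (G : set (T * U)) : Prop :=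
  forall s t a b, G (s, a) -> G (t, b) -> (s = t <-> a = b).

Lemma partial_inj_bigcup T U (F : set (set (T * U))) :
  F `<=` @partial_inj T U -> total_on F subset ->
  partial_inj (\bigcup_(G in F) G).
Proof.
move=> Finj Ftot s t a b [G FG Gsa] [H FH Htb].
have [GH|HG] := Ftot _ _ FG FH.
- by apply: (Finj _ FH) => //; exact: GH.
- by apply: (Finj _ FG) => //; exact: HG.
Qed.

Lemma partial_injU T U (G H : set (T * U)) :
  partial_inj G -> partial_inj H ->
  (forall s t a b, G (s, a) -> H (t, b) -> s <> t /\ a <> b) ->
  partial_inj (G `|` H).
Proof.
move=> Ginj Hinj GH s t a b [Gsa|Hsa] [Gtb|Htb].
- exact: Ginj.
- by have [st ab] := GH _ _ _ _ Gsa Htb; split.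
- by have [st ab] := GH _ _ _ _ Gtb Hsa; split=> [/esym|/esym].
- exact: Hinj.
Qed.

(** A maximal partial injection between [A] and [B] exhausts one of the two sets, as otherwise a
    pair could be added to it. The points of [U] and [T] only serve as default values outside [A]
    and [B]. *)
Lemma comparable_inj T U (A : set T) (B : set U) : U -> T ->
  (exists2 f : T -> U, set_fun A B f & {in A &, injective f}) \/
  (exists2 f : U -> T, set_fun B A f & {in B &, injective f}).
Proof.
move=> u0 t0.
have [|G [[GAB Ginj] Gmax]] := @Zorn_bigcup _
    [set G : set (T * U) | G `<=` A `*` B /\ partial_inj G].
  move=> F FP Ftot; split; first by move=> x [G /FP[GAB _]]; exact: GAB.
  by apply: partial_inj_bigcup => // G /FP[].
have [Adom|/existsNP[a /not_implyP[Aa aN]]] :=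
    pselect (forall a, A a -> exists b, G (a, b)).
  left; have /choice[f fP] a : exists b, A a -> G (a, b).
    have [/Adom[b Gab]|Aa] := pselect (A a); first by exists b.
    by exists u0.
  exists f => [a /fP/GAB[]//|a b /set_mem/fP Ga /set_mem/fP Gb].
  by have [_] := Ginj _ _ _ _ Ga Gb.
right; have Bdom b : B b -> exists a, G (a, b).
  move=> Bb; apply: contrapT => bN; apply: (Gmax (G `|` [set (a, b)])).
    split; first by apply: subsetUl.
    by move=> /(_ (a, b) (or_intror erefl)) Gab; apply: aN; exists b.
  split; first by rewrite subUset; split => // _ ->.
  apply: partial_injU => // [s t x y [-> ->] [-> ->]//|s t x y Gsx [-> ->]].
  by split=> [sa|xb]; [apply: aN; exists x; rewrite -sa
                      |apply: bN; exists s; rewrite -xb].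
have /choice[f fP] b : exists a, B b -> G (a, b).
  have [/Bdom[a' Gab]|Bb] := pselect (B b); first by exists a'.
  by exists t0.
exists f => [b /fP/GAB[]//|b c /set_mem/fP Gb /set_mem/fP Gc fbc].
by apply/(Ginj _ _ _ _ Gb Gc).
Qed.

(** * Finite sequences over an infinite type *)

Section InjSeq.
Variables (A : Type).
Implicit Types (s t : seq A) (G : set (seq A * A)).

Definition seq_dom G : set A := [set a | exists b, G ([:: a], b)].

(* Graphs of injections from the nonempty sequences over a set [B] into [B];
   the set is recovered as [seq_dom]. Excluding the empty sequence makes the
   empty graph such a one, as Zorn's lemma wants. *)
Definition seq_inj G : Prop :=
  [/\ partial_inj G,
      forall s a, G (s, a) -> all (mem (seq_dom G)) (a :: s) &
      forall s, s <> [::] -> all (mem (seq_dom G)) s -> exists a, G (s, a)].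

(** A sequence has finitely many letters, so in a chain one graph already has all of them in its
    domain. *)
Lemma seq_dom_bigcup (F : set (set (seq A * A))) s G0 :
  total_on F subset -> F G0 ->
  all (mem (seq_dom (\bigcup_(G in F) G))) s ->
  exists2 G, F G & all (mem (seq_dom G)) s.
Proof.
move=> Ftot FG0; elim: s => [_|a s IH /= /andP[/set_mem[b [G FG Gab]]]].
  by exists G0.
move=> /IH[H FH Hs]; have [GH|HG] := Ftot _ _ FG FH.
  exists H => //; rewrite Hs andbT; apply/mem_set; exists b; exact: GH.
exists G => //; apply/andP; split; first by apply/mem_set; exists b.
by apply: sub_all Hs => x /set_mem[y Hxy]; apply/mem_set; exists y; exact: HG.
Qed.

Lemma seq_inj_bigcup (F : set (set (seq A * A))) :
  F `<=` seq_inj -> total_on F subset -> seq_inj (\bigcup_(G in F) G).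
Proof.
move=> FP Ftot; split.
- by apply: partial_inj_bigcup => // G /FP[].
- move=> s a [G FG Gsa]; have [_ + _] := FP _ FG => /(_ _ _ Gsa).
  by apply: sub_all => x /set_mem[y Gxy]; apply/mem_set; exists y; exists G.
- case=> // x s _ xs; have /andP[/set_mem[y [G0 FG0 _]] _] := xs.
  have [G FG Gs] := seq_dom_bigcup Ftot FG0 xs.
  have [_ _ /(_ (x :: s))[//|//|a Ga]] := FP _ FG.
  by exists a; exists G.
Qed.

(** Sequences of naturals are countable; this graph shows that a maximal one is nonempty. *)
Lemma seq_inj_nat (i : nat -> A) : injective i ->
  seq_inj [set sa | exists2 l, l <> [::] & sa = (map i l, i (pickle l))].
Proof.
move=> i_inj; set G := [set sa | _].
have Gdom n : seq_dom G (i n).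
  by exists (i (pickle [:: n])); exists [:: n].
split.
- move=> s t a b [l _ [-> ->]] [m _ [-> ->]]; split.
    by move=> /(inj_map i_inj) ->.
  by move=> /i_inj /(pcan_inj pickleK) ->.
- move=> s a [l _ [-> ->]]; rewrite /= mem_set//=.
  by elim: l => //= n l ->; rewrite mem_set.
- move=> s s0 sG; suff [l sl] : exists l, s = map i l.
    exists (i (pickle l)); exists l; last by rewrite sl.
    by move=> l0; rewrite l0 in sl.
  elim: s {s0} sG => [_|a s IH /= /andP[/set_mem[b [[//|n l] _ []]] -> _ _]].
    by exists [::].
  by move=> /IH[m ->]; exists (n :: m).
Qed.

(** A code over [B] for sequences with letters outside [B]: each letter becomes a block of two,
    whose first entry tells whether [d] was applied to the second. With [u <> v] the code can be
    read back. *)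
Definition tag_seq (B : set A) (d : A -> A) u v s : seq A :=
  flatten [seq if x \in B then [:: u; x] else [:: v; d x] | x <- s].

Lemma tag_seq_inj (B D : set A) d u v : u <> v ->
  {in D `\` B &, injective d} ->
  forall s t, all (mem D) s -> all (mem D) t ->
  tag_seq B d u v s = tag_seq B d u v t -> s = t.
Proof.
move=> uv d_inj; elim=> [|x s IH] [|y t] //=.
- by rewrite /tag_seq /=; case: ifP.
- by rewrite /tag_seq /=; case: ifP.
- move=> /andP[Dx Ds] /andP[Dy Dt]; rewrite /tag_seq /=.
  case: ifPn => xB; case: ifPn => yB //= [].
  + by move=> -> /(IH _ Ds Dt) ->.
  + by move=> /uv.
  + by move=> /esym /uv.
  + by move=> /d_inj xy /(IH _ Ds Dt) ->; rewrite xy// inE; split;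
      [exact/set_mem|exact/notin_setP|exact/set_mem|exact/notin_setP].
Qed.

Lemma tag_seq_all (B D : set A) d u v s : B u -> B v ->
  set_fun (D `\` B) B d -> all (mem D) s -> all (mem B) (tag_seq B d u v s).
Proof.
move=> Bu Bv dB; rewrite /tag_seq; elim: s => //= x s IH /andP[Dx /IH].
rewrite all_cat => ->; rewrite andbT; case: ifPn => xB /=; rewrite !mem_set//.
  exact/set_mem.
by apply: dB; split; [exact/set_mem|exact/notin_setP].
Qed.

End InjSeq.

(** Let [B] be the domain of a maximal [G]. If the complement of [B] injects into [B], all sequences
    are coded by sequences over [B], to which [G] applies. Otherwise some [c] injects [B] into its
    complement, and [G] extends to [B] together with its image under [c]: a sequence with a letter
    outside [B] is coded over [B], sent into [B] by [G], then out of [B] by [c]. *)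
Lemma card_le_seq (A : Type) :
  infinite_set [set: A] -> [set: seq A] #<= [set: A].
Proof.
move=> /infiniteP /card_leTP[i i_inj].
have [|G [[Ginj Gdom Gtot] Gmax]] := @Zorn_bigcup _ (@seq_inj A).
  exact: seq_inj_bigcup.
set B := seq_dom G in Gdom Gtot *.
have [u [v [Bu Bv uv]]] : exists u v, [/\ B u, B v & u <> v].
  have [[x Bx]|B0] := pselect (B !=set0).
    have [a Ga] : exists a, G ([:: x], a).
      by apply: Gtot => //=; rewrite mem_set.
    have [b Gb] : exists b, G ([:: x; x], b).
      by apply: Gtot => //=; rewrite !mem_set.
    exists a, b; split.
    - by have /andP[/set_mem] := Gdom _ _ Ga.
    - by have /andP[/set_mem] := Gdom _ _ Gb.
    - by move=> /(Ginj _ _ _ _ Ga Gb).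
  have G0 : G = set0.
    apply/seteqP; split=> // -[s a] /Gdom /andP[/set_mem Ba _].
    by apply: B0; exists a.
  exfalso; apply: Gmax (seq_inj_nat i_inj); rewrite G0; split=> //.
  by move=> /(_ ([:: i 0%N], i (pickle [:: 0%N]))); apply; exists [:: 0%N].
have /choice[g gP] s : exists a, s <> [::] -> all (mem B) s -> G (s, a).
  have [[s0 sB]|] := pselect (s <> [::] /\ all (mem B) s).
    by have [a Ga] := Gtot s s0 sB; exists a.
  by move=> sN; exists u => s0 sB; case: sN.
have [[c cB c_inj]|[d dB d_inj]] := comparable_inj B (~` B) u u; last first.
  (* The leading [u] keeps the argument of [g] nonempty even for empty [s]. *)
  apply/card_leTP; exists (fun s => g (u :: tag_seq B d u v s)) => s t gst.
  have sT r : all (mem [set: A]) r by apply/allT => x; exact: mem_set.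
  have rB r : G (u :: tag_seq B d u v r, g (u :: tag_seq B d u v r)).
    apply: gP => //=; rewrite mem_set//=.
    by apply: (@tag_seq_all _ _ setT) => // x [_]; exact: dB.
  have /(Ginj _ _ _ _ (rB s) (rB t))[] := gst.
  apply: (@tag_seq_inj _ _ setT) => // x y /set_mem[_ /= xB] /set_mem[_ /= yB].
  by apply: d_inj; exact: mem_set.
(* [d] inverts [c] on the image of [B]. *)
have /choice[d dP] x : exists y, forall z, B z -> x = c z -> y = z.
  have [[z [Bz ->]]|xN] := pselect (exists z, B z /\ x = c z).
    by exists z => z' Bz' /c_inj; apply; exact: mem_set.
  by exists u => z Bz xz; case: xN; exists z.
pose D := B `|` c @` B; pose tag := tag_seq B d u v.
have dD : set_fun (D `\` B) B d.
  by move=> x [[//|[z Bz <-] _]]; rewrite (dP _ z).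
have d_inj : {in D `\` B &, injective d}.
  move=> x y /set_mem[[//|[z Bz <-] _]] /set_mem[[//|[w Bw <-] _]].
  by rewrite (dP _ z)// (dP _ w)// => ->.
pose H := [set sa | [/\ all (mem D) sa.1, ~~ all (mem B) sa.1 &
                        exists2 b, G (tag sa.1, b) & sa.2 = c b]].
have GB s a : G (s, a) -> B a by move=> /Gdom /andP[/set_mem].
have HP s : all (mem D) s -> ~~ all (mem B) s -> exists a, H (s, a).
  move=> sD sB; have [|b Gb] := Gtot (tag s) _ (tag_seq_all Bu Bv dD sD).
    by case: s {sD} sB => //= x s _; rewrite /tag /tag_seq /=; case: ifP.
  by exists (c b); split=> //; exists b.
have DE : seq_dom (G `|` H) = D.
  apply/seteqP; split=> x.
    case=> b [Gxb|[/= /andP[/set_mem//]]]; left; by exists b.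
  move=> Dx; have [Bx|xB] := pselect (B x).
    by have [b Gxb] := Bx; exists b; left.
  have [||a Ha] := HP [:: x]; [by rewrite /= mem_set| |by exists a; right].
  by rewrite /= andbT; exact/notin_setP.
exfalso; apply: (Gmax (G `|` H)).
  split; first exact: subsetUl.
  have [||a Ha] := HP [:: c u].
  - by rewrite /= mem_set//; right; exists u.
  - by rewrite /= andbT; apply/notin_setP; exact: cB.
  move=> /(_ ([:: c u], a) (or_intror Ha)) Ga.
  by apply: (cB u Bu); exists a.
split.
- apply: partial_injU => //.
    move=> s t a b [/= sD _ [x Gx ->]] [/= tD _ [y Gy ->]].
    have [stxy xyst] := Ginj _ _ _ _ Gx Gy; split=> [st|].
      by rewrite stxy// st.
    move=> /c_inj -/(_ (mem_set (GB _ _ Gx)) (mem_set (GB _ _ Gy))) /xyst.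
    exact: (tag_seq_inj uv d_inj).
  move=> s t a b Gsa [/= tD tB [x Gx ->]]; split.
    by move=> st; have /andP[_] := Gdom _ _ Gsa; rewrite st; exact/negP.
  by move=> acx; apply: (cB x (GB _ _ Gx)); rewrite -acx; exact: GB Gsa.
- move=> s a; rewrite DE => -[Gsa|[/= sD _ [b /GB Bb ->]]].
    by apply: sub_all (Gdom _ _ Gsa) => x /set_mem Bx; apply/mem_set; left.
  by rewrite sD mem_set//; right; exists b.
- move=> s s0; rewrite DE => sD; have [sB|sB] := boolP (all (mem B) s).
    by have [a Ga] := Gtot s s0 sB; exists a; left.
  by have [a Ha] := HP s sD sB; exists a; right.
Qed.

(** * Families of fewer than [p] subsets of a countable set *)

Lemma finite_set_natP (A : set nat) :
  finite_set A <-> exists N, forall n, A n -> (n < N)%N.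
Proof.
split=> [/finite_seqP[s ->]|[N AN]].
  by exists (\max_(i <- s) i).+1 => n ns; rewrite ltnS; exact: leq_bigmax_seq.
by apply: sub_finite_set (finite_II N) => n /AN.
Qed.

(** For infinite [Y], the sum embeds into sequences over [Y], the two summands being told apart by
    length. *)
Lemma card_le_sum_nat (P Y : Type) : ~ ([set: P] #<= [set: nat]) ->
  [set: P] #<= [set: (Y + nat)%type] -> [set: P] #<= [set: Y].
Proof.
move=> PN PYN; have [Yfin|Yinf] := pselect (finite_set [set: Y]).
  exfalso; apply: PN; apply: card_le_trans PYN _.
  have /card_leTP[f f_inj] := finite_set_countable Yfin.
  apply: (@card_le_trans _ _ _ [set: (nat + nat)%type]); last exact: countableP.
  apply/card_leTP; exists (fun y => match y with
    | inl y => inl (f y) | inr n => inr n end).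
  by move=> [y|n] [z|m] // []; [move=> /f_inj ->|move=> ->].
apply: card_le_trans PYN (card_le_trans _ (card_le_seq Yinf)).
have /infiniteP/card_leTP[i i_inj] := Yinf.
apply/card_leTP; exists (fun y => match y with
  | inl y => [:: y] | inr n => [:: i n; i n] end).
by move=> [y|n] [z|m] // []; [move=> ->|move=> /i_inj ->].
Qed.

Section Pseudointersection.
Variables (p : cardinal) (hp : is_pseudointersection_number p).
Hypothesis p_uncountable : ~ ([set: p] #<= [set: nat]).

(** The sets [E (M, s)] are closed under intersection and too few to lack a pseudointersection [P].
    Only finitely many codes in [P] violate a given condition, so their ranks [r] are bounded;
    choosing [u i] in [P] of rank at least [i] leaves them behind. *)
Lemma pseudointersection_seq (Y : Type) (D : countType) (G : set D)
    (r : D -> nat) (A : Y -> set D) :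
  ~ ([set: p] #<= [set: Y]) ->
  (forall s M, exists d,
     [/\ G d, (M <= r d)%N & all (fun y => d \in A y) s]) ->
  exists u : nat -> D, (forall i, G (u i) /\ (i <= r (u i))%N) /\
    forall y, \forall i \near \oo, A y (u i).
Proof.
move=> pY AP.
pose E (z : nat * seq Y) : set nat := [set n | exists2 d, n = pickle d &
  [/\ G d, (z.1 <= r d)%N & all (fun y => d \in A y) z.2]].
have pickle_inj : injective (@pickle D) := pcan_inj pickleK.
have Einf z : infinite_set (E z).
  move=> /finite_set_natP[N EN].
  (* A rank above those of all elements with code below [N] forces the code of [d] to be at least
     [N]. *)
  have [d [Gd Md Ad]] := AP z.2
    (maxn z.1 (\max_(i < N) oapp r 0 (@unpickle D i)).+1).
  have dN : (pickle d < N)%N.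
    apply: EN; exists d => //; split=> //; exact: leq_trans (leq_maxl _ _) Md.
  have := leq_trans (leq_maxr _ _) Md.
  by rewrite ltnNge (bigmax_sup (Ordinal dN))//= pickleK.
have [P [Pinf PE]] : exists P, pseudointersection (range E) P.
  apply: contrapT => noP.
  have /hp.2 pE : closed_family_without_pseudointersection (range E).
    split=> //; first by move=> _ [z _ <-]; exact: Einf.
    move=> _ _ [z _ <-] [z' _ <-].
    exists (maxn z.1 z'.1, z.2 ++ z'.2) => //; apply/seteqP; split=> n.
      move=> [d -> [Gd]] /=; rewrite geq_max all_cat.
      by move=> /andP[? ?] /andP[? ?]; split; exists d.
    move=> [[d -> [Gd zd Ad]] [d' /pickle_inj <- [_ zd' Ad']]].
    by exists d => //; split=> //=; rewrite ?geq_max ?all_cat; apply/andP.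
  (* The family is indexed by [nat * seq Y], hence no larger than [Y + nat], and [p] is
     uncountable. *)
  apply: pY; apply: card_le_sum_nat p_uncountable _.
  apply: (@card_le_trans _ _ _ [set: seq (Y + nat)%type]).
    apply: card_le_trans pE (card_le_trans (card_image_le _ _) _).
    apply/card_leTP; exists (fun z => inr z.1 :: [seq inl y | y <- z.2]).
    by move=> [M s] [N t] /= [-> /(inj_map (@inl_inj _ _)) ->].
  apply: card_le_seq; apply/infiniteP/card_leTP; exists inr; exact: inr_inj.
have /choice[u uP] i : exists d,
    [/\ P (pickle d), G d & (i <= r d)%N].
  have : infinite_set (P `&` E (i, [::])).
    move=> PEfin; apply: Pinf; rewrite -(setUIDK P (E (i, [::]))).
    by rewrite finite_setU; split=> //; apply: PE; exists (i, [::]).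
  by move=> /infinite_setN0[n [Pn [d nd [Gd Md _]]]]; exists d; rewrite -nd.
exists u; split=> [i|y]; first by have [] := uP i.
have /finite_set_natP[N PN] : almost_subset P (E (0%N, [:: y])).
  by apply: PE; exists (0%N, [:: y]).
exists (\max_(i < N) oapp r 0 (@unpickle D i)).+1 => // i /= Ni.
have [Pui Gui iui] := uP i; apply: contrapT => Ayui.
have uN : (pickle (u i) < N)%N.
  apply: PN; split=> // -[d /pickle_inj <- [_ _ /=]].
  by rewrite andbT => /set_mem.
have := leq_trans Ni iui.
by rewrite ltnNge (bigmax_sup (Ordinal uN))//= pickleK.
Qed.

End Pseudointersection.

(** * The linear order of a cardinal, from unique minima of nonempty subsets *)

Section CardinalOrder.
Variable kappa : cardinal.
Implicit Types a b c : kappa.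
Let R := @card_rel kappa.

Let min_of (A : set kappa) : A !=set0 ->
  exists2 z, A z & forall a, A a -> R z a.
Proof.
case=> a Aa; have [|z [[zA zmin] _]] := @card_wo kappa (mem A).
  by exists a; exact: mem_set.
by exists z => [|b Ab]; [exact: set_mem|apply: zmin; exact: mem_set].
Qed.

Lemma card_rel_refl a : card_rel a a.
Proof. by have [|z <-] := @min_of [set a]; [exists a|exact]. Qed.

Lemma card_rel_total a b : card_rel a b \/ card_rel b a.
Proof.
have [|z [->|->] zmin] := @min_of [set a; b]; first by exists a; left.
- by left; apply: zmin; right.
- by right; apply: zmin; left.
Qed.

Lemma card_rel_antisym a b : card_rel a b -> card_rel b a -> a = b.
Proof.
move=> ab ba; have [|z [_ zuniq]] := @card_wo kappa (mem [set a; b]).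
  by exists a; rewrite !inE; left.
rewrite -(zuniq a) ?(zuniq b)//; split=> [|c]; rewrite !inE /=.
- by right.
- by case=> ->//; exact: card_rel_refl.
- by left.
- by case=> ->//; exact: card_rel_refl.
Qed.

Lemma card_rel_trans b a c : card_rel a b -> card_rel b c -> card_rel a c.
Proof.
move=> ab bc; have [|z zabc zmin] := @min_of [set a; b; c].
  by exists a; left; left.
have za : R z a by apply: zmin; left; left.
have zb : R z b by apply: zmin; left; right.
have zc : R z c by apply: zmin; right.
case: zabc => [[/= ze|/= ze]|/= ze]; rewrite {}ze in za zb zc => //.
- by rewrite (card_rel_antisym ab za).
- by rewrite -(card_rel_antisym bc zb).
Qed.

Lemma ord_ltNge a b : ~ ord_lt a b <-> card_rel b a.
Proof.
split=> [abN|ba [ab]]; last by apply; exact: card_rel_antisym.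
have [ab|//] := card_rel_total a b.
have [->|nab] := pselect (a = b); first exact: card_rel_refl.
by case: abN; split.
Qed.

Lemma ord_lt_le_trans b a c : ord_lt a b -> card_rel b c -> ord_lt a c.
Proof.
move=> ab bc; apply: contrapT => /ord_ltNge ca.
by move: ab; apply/ord_ltNge; exact: card_rel_trans bc ca.
Qed.

End CardinalOrder.

(** * Unbounded towers and the intervals missed by their members *)

Lemma almost_subsetP (A B : set nat) :
  almost_subset A B <-> exists N, forall n, (N <= n)%N -> A n -> B n.
Proof.
split=> [/finite_set_natP[N ABN]|[N ABN]].
  exists N => n Nn An; apply: contrapT => Bn.
  by have := ABN n (conj An Bn); rewrite ltnNge Nn.
apply/finite_set_natP; exists N => n [An Bn]; rewrite ltnNge; apply/negP => Nn.
by apply: Bn; exact: ABN.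
Qed.

Definition gap (A : set nat) (a b : nat) : Prop :=
  forall n, A n -> ~~ (a <= n < b)%N.

(** If [A] meets every interval from the [N]-th on, its [i]-th element lies below [b (N + i)], so a
    failure for all [A] would bound the family. *)
Lemma unbounded_family_gap (T : set (set nat)) (a b : nat -> nat) :
  unbounded_family T -> (forall n, a n < b n <= a n.+1)%N ->
  exists2 A, T A & forall N, exists2 n, (N <= n)%N & gap A (a n) (b n).
Proof.
move=> Tunb ab; apply: contrapT => noA; apply: Tunb.
have b_mono : {homo b : m n / (m <= n)%N}.
  apply: homo_leq => [//|? ? ?|n]; first exact: leq_trans.
  have /andP[_ /leq_trans] := ab n; apply.
  by have /andP[/ltnW] := ab n.+1.
(* [N] depends on [A]; doubling absorbs it, as [N + i] is at most [i.*2] once [N <= i]. *)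
exists (fun i => b i.*2) => A e TA [e_incr eA].
have [N AN] : exists N, forall n, (N <= n)%N ->
    exists2 m, A m & (a n <= m < b n)%N.
  apply: contrapT => noN; apply: noA; exists A => // N.
  apply: contrapT => gapN; apply: noN; exists N => n Nn.
  apply: contrapT => noM; apply: gapN; exists n => // m Am.
  by apply/negP => amb; apply: noM; exists m.
have /choice[j jP] i : exists j, (a (N + i) <= e j < b (N + i))%N.
  have [m Am mP] := AN (N + i)%N (leq_addr _ _).
  by move: Am; rewrite -eA => -[j _ jm]; exists j; rewrite jm.
have e_mono := leq_mono e_incr.
have ij i : (i <= j i)%N.
  elim: i => // i ih; apply: leq_ltn_trans ih _.
  rewrite -(leqW_mono e_mono).
  have /andP[_ /leq_trans] := jP i; apply.
  have /andP[+ _] := jP i.+1; apply: leq_trans.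
  by rewrite addnS; have /andP[] := ab (N + i)%N.
exists N => // i /= Ni; apply: (@leq_trans (e (j i))); first by rewrite e_mono.
have /andP[_ /ltnW /leq_trans] := jP i; apply; apply: b_mono.
by rewrite -addnn leq_add2r.
Qed.

Section UnboundedTower.
Variables (p : cardinal) (T : set (set nat)) (x : p -> set nat).
Hypotheses (Tinf : T `<=` inf_subsets) (xT : range x = T).
Hypothesis x_tower : forall a b : p, ord_lt a b -> almost_subset (x b) (x a).
Hypothesis Tunb : unbounded_family T.

Lemma tower_le a b : card_rel a b ->
  exists N, forall n, (N <= n)%N -> x b n -> x a n.
Proof.
move=> ab; apply/almost_subsetP.
have [<-|nab] := pselect (a = b); first by rewrite /almost_subset setDv.
by apply: x_tower; split.
Qed.

Lemma tower_gap (a b : nat -> nat) : (forall n, a n < b n <= a n.+1)%N ->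
  exists c, forall N, exists2 n, (N <= n)%N & gap (x c) (a n) (b n).
Proof.
by move=> /(unbounded_family_gap Tunb)[A]; rewrite -xT => -[c _ <-]; exists c.
Qed.

Lemma tower_inf a N : exists2 n, (N <= n)%N & x a n.
Proof.
apply: contrapT => noN.
have : infinite_set (x a) by apply: Tinf; rewrite -xT; exists a.
apply; apply/finite_set_natP; exists N => n xan; rewrite ltnNge.
by apply/negP => Nn; apply: noN; exists n.
Qed.

(* A countable cofinal subset of the tower would bound it: cut [nat] into
   intervals, the [i]-th one meeting the first [i] members of that subset. *)
Lemma tower_countable_ub (u : nat -> p) : exists c, forall k, ord_lt (u k) c.
Proof.
apply: contrapT => noc.
have {noc} cofu c : exists k, card_rel c (u k).
  apply: contrapT => nok; apply: noc; exists c => k.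
  by apply: contrapT => /ord_ltNge ck; apply: nok; exists k.
have /choice[next nextP] (z : nat * nat) : exists m, (z.2 < m)%N /\
    forall j, (j <= z.1)%N -> exists2 n, (z.2 <= n < m)%N & x (u j) n.
  have /choice[f fP] j : exists n, (z.2 <= n)%N /\ x (u j) n.
    by have [n zn xn] := tower_inf (u j) z.2; exists n.
  exists (maxn z.2 (\max_(j < z.1.+1) f j)).+1; split.
    by rewrite ltnS leq_maxl.
  move=> j jz; exists (f j); last by have [] := fP j.
  have [-> _] := fP j; rewrite ltnS leq_max; apply/orP; right.
  by have jz' : (j < z.1.+1)%N by []; exact: (bigmax_sup (Ordinal jz')).
pose c := fix c i := if i is i'.+1 then next (i', c i') else 0%N.
have c_lt i : (c i < c i.+1)%N by have [] := nextP (i, c i).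
have [|a aP] := @tower_gap c (c \o succn).
  by move=> n /=; rewrite c_lt leqnn.
have [k ak] := cofu a; have [N NP] := tower_le ak.
have [n Nn agap] := aP (maxn N k).
have [m /andP[cm mc] um] : exists2 m, (c n <= m < c n.+1)%N & x (u k) m.
  have [_ /(_ k)] := nextP (n, c n); apply.
  exact: leq_trans (leq_maxr _ _) Nn.
have cn i : (i <= c i)%N by elim: i => // i /leq_ltn_trans; apply.
have : x a m.
  apply: NP um; apply: leq_trans cm; apply: leq_trans (cn n).
  exact: leq_trans (leq_maxl _ _) Nn.
by move=> /agap; rewrite /= cm mc.
Qed.

Lemma tower_inhabited : inhabited p.
Proof.
by have [|c _] := @tower_gap id succn => [n|]; rewrite ?ltnSn ?leqnn.
Qed.

(** Otherwise [u] would enumerate [p], and a strict upper bound of [u] would lie above itself. *)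
Lemma tower_uncountable : ~ ([set: p] #<= [set: nat]).
Proof.
have [c0] := tower_inhabited => /card_leTP[f f_inj].
have /choice[u uP] n : exists c, forall a, f a = n -> c = a.
  have [[a fa]|noa] := pselect (exists a, f a = n).
    by exists a => b; rewrite -fa => /f_inj.
  by exists c0 => a fa; case: noa; exists a.
have [c /(_ (f c)) [_]] := tower_countable_ub u.
by rewrite (uP _ c).
Qed.

End UnboundedTower.

(** * Basic open sets and omega-covers *)

Definition trace (b : nat) (A : set nat) : seq bool :=
  mkseq (fun i => i \in A) b.

Lemma eq_trace b A B : (forall i, (i < b)%N -> A i <-> B i) ->
  trace b A = trace b B.
Proof.
move=> AB; apply: (@eq_from_nth _ false); rewrite !size_mkseq// => i ib.
by rewrite !nth_mkseq//; apply/idP/idP; rewrite !inE => /AB; apply.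
Qed.

Lemma trace_eq m b A B : (m <= b)%N -> trace b A = trace b B ->
  forall i, (i < m)%N -> A i <-> B i.
Proof.
move=> mb tAB i im; have ib := leq_trans im mb.
have := congr1 (nth false ^~ i) tAB; rewrite !nth_mkseq// => iAB.
by split=> /mem_set h; apply/set_mem; [rewrite -iAB|rewrite iAB].
Qed.

Lemma open_cantor_space (O : set cantor_space) (f : cantor_space) :
  open O -> O f -> exists m, forall g : cantor_space,
    (forall i, (i < m)%N -> f i = g i) -> O g.
Proof.
move=> oO Of; apply: contrapT => noM.
have /choice[g gP] m : exists g : cantor_space,
    (forall i, (i < m)%N -> f i = g i) /\ ~ O g.
  apply: contrapT => nog; apply: noM; exists m => g fg.
  by apply: contrapT => Og; apply: nog; exists g.
have g_cvg : g @ \oo --> f.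
  apply/cvg_sup => i U [V] [[W] oW <-] WfN WU.
  apply: (filterS WU); rewrite nbhs_simpl; exists i.+1 => // m /= im.
  by have [/(_ i im) <- _] := gP m.
have /g_cvg : nbhs f O by exact: open_nbhs_nbhs.
by rewrite nbhs_simpl => -[N _ /(_ N (leqnn N))]; have [] := gP N.
Qed.

Section Subspace.
Variable S : set powerset_nat.
Local Notation X := (set_type S).

Lemma open_powerset_nat (V : set X) (y : X) : open V -> V y ->
  exists m, forall z : X,
    (forall i, (i < m)%N -> set_val y i <-> set_val z i) -> V z.
Proof.
move=> [_ [W oW <-] <-] /= Oy; have [m Om] := open_cantor_space oW Oy.
exists m => z yz; apply: Om => i /yz im.
by apply/idP/idP; rewrite !inE => /im; apply.
Qed.

Hypothesis S_fin : fin_subsets `<=` S.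

Let finpt_subproof (t : seq bool) : [set i | nth false t i] \in S.
Proof.
apply/mem_set/S_fin/finite_set_natP; exists (size t) => i /= ti.
by rewrite ltnNge; apply/negP => /(nth_default false) tF; rewrite tF in ti.
Qed.

Let finpt t : X := SigSub (finpt_subproof t).

Let finptE t i : set_val (finpt t) i = nth false t i.
Proof. by []. Qed.

(* Galvin and Miller: a member of the cover containing all subsets of [0, a)
   contains every point without elements in [a, b) for some [b]. The
   members are chosen among the countably many data [(a, b, s)], [s] standing
   for the clopen set of points whose trace on [b] is in [s]; this is what
   makes the definition of the pseudointersection number applicable. *)
Lemma omega_cover_gap (p : cardinal) (Y : Type) (y : Y -> X)
    (U : set (set X)) :
  is_pseudointersection_number p -> ~ ([set: p] #<= [set: nat]) ->
  ~ ([set: p] #<= [set: Y]) -> Omega U ->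
  exists (a b : nat -> nat) (V : nat -> set X),
    [/\ forall n, (a n < b n <= a n.+1)%N, forall n, U (V n),
        forall n z, gap (set_val z) (a n) (b n) -> V n z &
        forall t, \forall n \near \oo, V n (y t)].
Proof.
move=> hp pN pY [Uopen _ Ucov].
pose dec (d : nat * nat * seq (seq bool)) (z : X) :=
  trace d.1.2 (set_val z) \in d.2.
pose G d := (d.1.1 < d.1.2)%N /\ exists V, [/\ U V,
  forall z, dec d z -> V z &
  forall z : X, gap (set_val z) d.1.1 d.1.2 -> dec d z].
have [|u [uG uA]] := @pseudointersection_seq p hp pN Y
    (nat * nat * seq (seq bool))%type G (fun d => d.1.1)
    (fun t d => dec d (y t)) pY.
  move=> s M.
  pose F := [set` [seq y t | t <- s]] `|` finpt @` range (@tval M bool).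
  have Ffin : finite_set F.
    rewrite finite_setU; split; first exact: finite_seq.
    by do 2 apply: finite_image; exact: finite_finset.
  have [V UV FV] := Ucov F Ffin.
  have /choice[m mP] z : exists m, F z -> forall z' : X,
      (forall i, (i < m)%N -> set_val z i <-> set_val z' i) -> V z'.
    have [Fz|] := pselect (F z); last by exists 0%N.
    by have [m mP] := open_powerset_nat (Uopen _ UV) (FV _ Fz); exists m.
  have /finite_set_natP[N mN] : finite_set (m @` F) by exact: finite_image.
  (* Beyond [M], so that the interval is nonempty, and beyond all moduli [m z], so that the trace on
     [b] decides membership in [V]. *)
  pose b := maxn M.+1 N.
  have [r rP] : exists r : seq (seq bool), [set` r] = (trace b \o set_val) @` F.
    have /finite_seqP[r ->] : finite_set ((trace b \o set_val) @` F).
      exact: finite_image.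
    by exists r.
  have Fr z : F z -> trace b (set_val z) \in r.
    move=> Fz; suff : [set` r] (trace b (set_val z)) by [].
    by rewrite rP; exists z.
  exists (M, b, r); split=> //; last first.
    apply: (@sub_all _ (preim y (dec (M, b, r)))) => [t dt|].
      exact: mem_set.
    by rewrite -all_map; apply/allP => z zs; apply: Fr; left.
  split=> /=; first by rewrite leq_max leqnn.
  exists V; split=> // z.
    move=> /= zr; have : [set` r] (trace b (set_val z)) by [].
    rewrite rP => -[z' Fz' /= zz']; apply: (mP z' Fz').
    apply: trace_eq zz'; rewrite leq_max; apply/orP; right; apply: ltnW.
    by apply: mN; exists z'.
  move=> zgap; rewrite /dec /=.
  have -> : trace b (set_val z) =
            trace b (set_val (finpt (trace M (set_val z)))).
    apply: eq_trace => i ib; rewrite finptE /trace.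
    have [iM|Mi] := ltnP i M; first by rewrite nth_mkseq// inE.
    rewrite nth_default ?size_mkseq//; split=> // /zgap.
    by rewrite Mi ib.
  apply: Fr; right; exists (trace M (set_val z)) => //.
have /choice[V VP] i : exists V, [/\ U V, forall z, dec (u i) z -> V z &
    forall z : X, gap (set_val z) (u i).1.1 (u i).1.2 -> V z].
  have [[_ [V [UV dV gV]]] _] := uG i.
  by exists V; split=> // z /gV/dV.
(* Each right end is the next index; since [u i] starts at [i] or later, the intervals become
   successive. *)
pose h := fix h n := if n is n'.+1 then (u (h n')).1.2 else 0%N.
have u_lt i : ((u i).1.1 < (u i).1.2)%N by have [[]] := uG i.
have u_le i : (i <= (u i).1.1)%N by have [_] := uG i.
have h_ge n : (n <= h n)%N.
  elim: n => // n nh; apply: leq_ltn_trans (u_lt _).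
  exact: leq_trans nh (u_le _).
exists (fun n => (u (h n)).1.1), (fun n => (u (h n)).1.2), (V \o h); split.
- by move=> n; rewrite u_lt /= u_le.
- by move=> n; have [] := VP (h n).
- by move=> n; have [] := VP (h n).
- move=> t; have [N _ NA] := uA t; exists N => // n /= Nn.
  have [_ + _] := VP (h n); apply; apply: NA.
  exact: leq_trans (h_ge n).
Qed.

(** For infinity of the range: each member [W] omits a point that lies in [V n] from [f W] on. Were
    the range finite, some [N] would exceed all these thresholds, and [V N] would contain the point
    it omits. *)
Lemma gamma_of_cofinite (V : nat -> set X) : (forall n, open (V n)) ->
  (forall n, V n <> setT) -> (forall z, \forall n \near \oo, V n z) ->
  Gamma (range V).
Proof.
move=> Vopen VT Vnear; split=> [fV|_ [n _ <-]//|[n _ /VT]//|z]; last first.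
  have [N _ NV] := Vnear z.
  apply: (@sub_finite_set _ _ (V @` `I_N)); last exact: finite_image.
  move=> _ [[n _ <-] Vz]; exists n => //=; rewrite ltnNge; apply/negP => Nn.
  by apply: Vz; exact: NV.
have /choice[f fP] (W : set X) : exists N, W <> setT ->
    exists z, ~ W z /\ forall n, (N <= n)%N -> V n z.
  have [[z Wz]|noz] := pselect (exists z, ~ W z).
    by have [N _ NV] := Vnear z; exists N => _; exists z.
  exists 0%N; case; apply/seteqP; split=> // z _; apply: contrapT => Wz.
  by apply: noz; exists z.
have /finite_set_natP[N fN] : finite_set (f @` range V) by exact: finite_image.
have [z [Vz NV]] := fP _ (VT N); apply: Vz.
by apply: NV; apply: ltnW; apply: fN; exists (V N) => //; exists N.
Qed.

End Subspace.

(** * Selection from a sequence of omega-covers of the tower with the finite sets *)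

Section GammaSet.
Variables (p : cardinal) (hp : is_pseudointersection_number p).
Variables (T : set (set nat)) (x : p -> set nat).
Hypotheses (Tinf : T `<=` inf_subsets) (xT : range x = T).
Hypothesis x_tower : forall a b : p, ord_lt a b -> almost_subset (x b) (x a).
Hypothesis Tunb : unbounded_family T.

Let X := set_type ((T `|` fin_subsets) : set powerset_nat).

Let pN : ~ ([set: p] #<= [set: nat]).
Proof. exact: (tower_uncountable Tinf xT x_tower Tunb). Qed.

Let pt_subproof a : x a \in ((T `|` fin_subsets) : set powerset_nat).
Proof. by apply/mem_set; left; rewrite -xT; exists a. Qed.

Let pt a : X := SigSub (pt_subproof a).

Lemma segment_not_ge (c : p) : ~ ([set: p] #<= [set: {a : p | ord_lt a c}]).
Proof.
move=> /card_leTP[f f_inj]; apply: (@card_initial p c).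
have g_inj : injective (fun a => sval (f a)).
  move=> a b fab; apply: f_inj; move: fab.
  by case: (f a) (f b) => [u uc] [v vc] /= uv; exact: eq_exist.
apply: (@card_le_trans _ _ _ (range (fun a => sval (f a)))).
  by rewrite (card_le_eqr (inj_card_eq (in2W g_inj))).
by apply: subset_card_le => _ [a _ <-]; have [] := svalP (f a).
Qed.

Lemma tower_cover_step (c : p) (U : set (set X)) : Omega U ->
  exists (d : p) (a b : nat -> nat) (V : nat -> set X),
    [/\ card_rel c d, forall n, (n <= a n)%N,
        forall n, U (V n) /\
          forall z, gap (set_val z) (a n) (b n) -> V n z,
        forall n, gap (x d) (a n) (b n) &
        forall e, ord_lt e c -> \forall n \near \oo, V n (pt e)].
Proof.
move=> OU.
have [a [b [V [ab UV gapV Vnear]]]] :=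
  omega_cover_gap (@subsetUr _ T fin_subsets)
  (fun e : {e : p | ord_lt e c} => pt (sval e)) hp pN (@segment_not_ge c) OU.
have a_ge n : (n <= a n)%N.
  elim: n => // n /leq_ltn_trans na; have /andP[/na nb /(leq_trans nb)] := ab n.
  exact.
have [d cd dgap] : exists2 d, card_rel c d &
    forall N, exists n, (N <= n)%N /\ gap (x d) (a n) (b n).
  have [d dP] := tower_gap xT Tunb ab.
  have [cd|dc] := card_rel_total c d.
    by exists d => // N; have [n] := dP N; exists n.
  (* If [d] does not come after [c], then [c] itself serves: [x c] is almost contained in [x d], and
     the intervals tend to infinity. *)
  have [N NP] := tower_le x_tower dc.
  exists c => [|M]; first exact: card_rel_refl.
  have [n] := dP (maxn M N); rewrite geq_max => /andP[Mn Nn] dgap.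
  exists n; split=> // m xcm; apply/negP => /andP[am mb].
  have /dgap : x d m.
    by apply: NP xcm; apply: leq_trans am; exact: leq_trans (a_ge n).
  by rewrite am mb.
have /choice[h hP] := dgap.
exists d, (a \o h), (b \o h), (V \o h); split=> //=.
- by move=> n; have [nh _] := hP n; exact: leq_trans nh (a_ge _).
- by move=> n; split=> [|z]; [exact: UV|exact: gapV].
- by move=> n; have [] := hP n.
- move=> e ec; have [N _ NV] := Vnear (exist _ e ec).
  exists N => // n /= Nn; apply: NV => /=; apply: leq_trans Nn _.
  by have [] := hP n.
Qed.

(** Pairs [(M, j)] are selected, where [j] has to bound [g e] on all arguments up to [M]. The [k]-th
    pair has [M] at least [k], so its second entry serves as [f k]. *)
Lemma segment_bounded (c : p) (g : p -> nat -> nat) :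
  exists f : nat -> nat,
    forall e, ord_lt e c -> \forall k \near \oo, (g e k <= f k)%N.
Proof.
have [|u [uG uA]] := @pseudointersection_seq p hp pN {e : p | ord_lt e c}
    (nat * nat)%type setT fst
    (fun e d => forall k, (k <= d.1)%N -> (g (sval e) k <= d.2)%N)
    (@segment_not_ge c).
  move=> s M; suff [j jP] : exists j,
      all (fun e => [forall k : 'I_M.+1, g (sval e) k <= j]%N) s.
    exists (M, j); split=> //; apply: sub_all jP => e /forallP ej.
    by apply/mem_set => k; rewrite /= -ltnS => kM; exact: (ej (Ordinal kM)).
  elim: s => [|e s [j jP]]; first by exists 0%N.
  exists (maxn j (\max_(k < M.+1) g (sval e) k)) => /=; apply/andP; split.
    by apply/forallP => k; rewrite leq_max; apply/orP; right; exact: leq_bigmax.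
  apply: sub_all jP => e' /forallP e'j; apply/forallP => k.
  by rewrite leq_max e'j.
exists (fun k => (u k).2) => e ec; have [N _ NA] := uA (exist _ e ec).
by exists N => // k /= /NA; apply; have [_] := uG k.
Qed.

Lemma unbounded_tower_gamma : gamma_set X.
Proof.
move=> U OU.
(* Choosing for every cover index and every starting point at once allows [c] to be defined by
   recursion. *)
have /choice[F FP] (z : nat * p) :
    exists d : p * (nat -> nat) * (nat -> nat) * (nat -> set X),
    [/\ card_rel z.2 d.1.1.1, forall n, (n <= d.1.1.2 n)%N,
        forall n, U z.1 (d.2 n) /\
          forall w, gap (set_val w) (d.1.1.2 n) (d.1.2 n) -> d.2 n w,
        forall n, gap (x d.1.1.1) (d.1.1.2 n) (d.1.2 n) &
        forall e, ord_lt e z.2 -> \forall n \near \oo, d.2 n (pt e)].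
  have [d [a [b [V VP]]]] := tower_cover_step z.2 (OU z.1).
  by exists (d, a, b, V).
have [c0] := tower_inhabited xT Tunb.
pose c := fix c k := if k is k'.+1 then (F (k', c k')).1.1.1 else c0.
pose a k := (F (k, c k)).1.1.2; pose b k := (F (k, c k)).1.2.
pose V k := (F (k, c k)).2.
have c_le k : card_rel (c k) (c k.+1) by have [] := FP (k, c k).
have a_ge k n : (n <= a k n)%N by have [_ + _ _ _] := FP (k, c k); apply.
have UV k n : U k (V k n) by have [_ _ /(_ n)[]] := FP (k, c k).
have gapV k n w : gap (set_val w) (a k n) (b k n) -> V k n w.
  by have [_ _ /(_ n)[_ FV] _ _] := FP (k, c k); exact: FV.
have cgap k n : gap (x (c k.+1)) (a k n) (b k n).
  by have [_ _ _ Fgap _] := FP (k, c k); exact: Fgap.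
have Vlow k e : ord_lt e (c k) -> \forall n \near \oo, V k n (pt e).
  by have [_ _ _ _ Flow] := FP (k, c k); exact: Flow.
have Vhigh k e : card_rel (c k.+1) e -> \forall n \near \oo, V k n (pt e).
  move=> /(tower_le x_tower)[N NP]; exists N => // n /= Nn.
  apply: gapV => m xem; apply/negP => /andP[am mb].
  have /cgap : x (c k.+1) m.
    by apply: NP xem; apply: leq_trans am; exact: leq_trans (a_ge k n).
  by move=> /(_ n); rewrite am mb.
have [w cw] := tower_countable_ub Tinf xT x_tower Tunb c.
have /choice[g gP] (z : p * nat) : exists N,
    (\forall n \near \oo, V z.2 n (pt z.1)) ->
    forall n, (N <= n)%N -> V z.2 n (pt z.1).
  have [[N _ NV]|noN] := pselect (\forall n \near \oo, V z.2 n (pt z.1)).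
    by exists N.
  by exists 0%N.
have [f fP] := segment_bounded w (fun e k => g (e, k)).
have /choice[h hP] k : exists N, forall n, (N <= n)%N -> x w n -> x (c k.+1) n.
  by apply: (tower_le x_tower); have [] := cw k.+1.
(* [f k] serves the points before [w], [k] drives the intervals to infinity, and [h k] makes [x w]
   miss the chosen interval. *)
pose n k := maxn (f k) (maxn k (h k)).
have na k : (k <= a k (n k))%N.
  by apply: leq_trans (a_ge k _); rewrite !leq_max leqnn orbT.
exists (fun k => V k (n k)); split=> //; apply: gamma_of_cofinite.
- by move=> k; have [Uopen _ _] := OU k; exact: Uopen.
- by move=> k VT; have [_ UT _] := OU k; apply: UT; rewrite -VT.
move=> z; have [Tz|/finite_set_natP[N zN]] : (T `|` fin_subsets) (set_val z).
  exact: set_valP.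
- have [e xe] : exists e, x e = set_val z.
    have [e _ xe] : range x (set_val z) by rewrite xT.
    by exists e.
  have -> : z = pt e by apply: val_inj; exact: esym xe.
  have [ew|/ord_ltNge we] := pselect (ord_lt e w); last first.
    have [N NP] := tower_le x_tower we.
    exists N => // k /= Nk; apply: gapV => m xem; apply/negP => /andP[am mb].
    have xwm : x w m.
      by apply: NP xem; apply: leq_trans Nk _; apply: leq_trans (na k) am.
    have /cgap : x (c k.+1) m.
      apply: hP xwm; apply: leq_trans am; apply: leq_trans (a_ge k _).
      by rewrite !leq_max leqnn !orbT.
    by move=> /(_ (n k)); rewrite am mb.
  have [M _ fM] := fP e ew.
  (* Either the point precedes some [c k0], hence all later ones, and [Vlow] applies from [k0] on;
     or it precedes none, and [Vhigh] applies for every [k]. *)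
  have [K KP] : exists K, forall k, (K <= k)%N ->
      \forall m \near \oo, V k m (pt e).
    have [[k0 ek0]|noc] := pselect (exists k, ord_lt e (c k)).
      exists k0 => k /subnK <-; apply: Vlow.
      elim: (k - k0)%N => // i IH; rewrite addSn.
      exact: ord_lt_le_trans IH (c_le _).
    exists 0%N => k _; apply: Vhigh; apply/ord_ltNge => ek.
    by apply: noc; exists k.+1.
  exists (maxn M K) => // k /=; rewrite geq_max => /andP[Mk Kk].
  apply: (gP (e, k)) => /=; first exact: KP.
  by apply: leq_trans (fM k Mk) _; exact: leq_maxl.
- exists N => // k /= Nk; apply: gapV => m /zN mN; apply/negP => /andP[am _].
  by move: mN; rewrite ltnNge (leq_trans Nk)// (leq_trans (na k)).
Qed.

End GammaSet.

Local Close Scope card_scope.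
Unset Implicit Arguments.

Theorem theorem2p3 (p : cardinal) (hp : is_pseudointersection_number p)
    (T : set (set nat)) (hT : unbounded_tower p T) :
  gamma_set (set_type ((T `|` fin_subsets) : set powerset_nat)).
Proof.
have [[Tinf [x [[xT _ Tx] x_tower]]] Tunb] := hT.
have rT : range x = T.
  by apply/seteqP; split=> [_ [a _ <-]|A /Tx]; [exact: xT|].
exact: (@unbounded_tower_gamma _ hp _ _ Tinf rT x_tower Tunb).
Qed.
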